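(* Let $p$ be a prime. For all integers $n,m,k\geq 0$, $$A_{n+pm+k,\,k}\equiv A_{n+m+k,\,m+k}\pmod p.$$
   Context: A partition of a finite set is a collection of nonempty, pairwise disjoint subsets (blocks) whose union is the set; a singleton of a partition is a block with exactly one element. For integers $0\leq k\leq n$, $A_{n,k}$ denotes the number of partitions of $\{1,2,\dots,n+1\}$ whose largest singleton is $k+1$ (i.e. $\{k+1\}$ is a block and no $j>k+1$ forms a singleton block). *)

(* Defs.v *)
From mathcomp Require Import all_boot.

Set Implicit Arguments.
Unset Strict Implicit.
Unset Printing Implicit Defensive.

(* The ordinal i : 'I_n.+1 stands for the element i + 1 of {1, ..., n+1}. *)
Definition largest_singleton (n : nat) (P : {set {set 'I_n.+1}}) (i : 'I_n.+1) : bool :=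
  ([set i] \in P) && [forall j : 'I_n.+1, (i < j) ==> ([set j] \notin P)].

(* As k ranges over nat, the existential selects the ordinal of value k;
   the value is 0 outside the intended range k <= n. *)
Definition A (n k : nat) : nat :=
  #|[set P : {set {set 'I_n.+1}} |
       partition P [set: 'I_n.+1]
       & [exists i : 'I_n.+1, (val i == k) && largest_singleton P i]]|.

(* Main.v *)
Require Import Defs.
From mathcomp Require Import all_boot.
From HB Require Import structures.
From mathcomp Require Import all_algebra finfield.

Set Implicit Arguments.
Unset Strict Implicit.
Unset Printing Implicit Defensive.

Import GRing.Theory.

(** Let [L] be the linear functional on polynomials sending ['X^n] to the
    [n]-th Bell number.  Inclusion-exclusion on forbidden singletons gives
    [A n k = L ('X^k * ('X - 1) ^+ (n - k))], and the Bell recurrence reads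
    [L ('X * f) = L (f \Po ('X + 1))].  Iterating the latter,
    [L ('X * ('X - 1) * ... * ('X - (p - 1)) * f) = L (f \Po ('X + p))]; over
    ['F_p] this says [L (('X^p - 'X) * f) = L f], so under [L] the polynomial
    [('X - 1) ^+ p = 'X^p - 1] may be replaced by ['X]. *)

(** * Set partitions with forbidden singleton blocks, and the Bell recurrence *)

Definition partitions_avoiding (T : finType) (D S : {set T}) :=
  [set P : {set {set T}} | partition P D & [forall s in S, [set s] \notin P]].

Definition bell (n : nat) := #|partitions_avoiding [set: 'I_n] set0|.

Section PartitionsAvoiding.

Variable T : finType.
Implicit Types (D S B C : {set T}) (P Q : {set {set T}}) (x : T).

(** Deleting the block [B] is a bijection with inverse [Q |-> B |: Q]. Since [S] misses [B], putting
    [B] back never creates a forbidden singleton. *)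
Lemma card_partitions_avoiding_block D S B :
    B \subset D -> B != set0 -> S \subset D :\: B ->
  #|[set P in partitions_avoiding D S | B \in P]|
    = #|partitions_avoiding (D :\: B) S|.
Proof.
move=> sBD nzB sSDB.
have Bnot Q : partition Q (D :\: B) -> B \notin Q.
  move=> parQ; apply: contra nzB => /(partitionS parQ).
  by rewrite subsetD => /andP[_]; rewrite -setI_eq0 setIid.
have neqB s : s \in S -> [set s] != B.
  move=> /(subsetP sSDB); rewrite inE => /andP[sNB _].
  by apply: contraNneq sNB => <-; rewrite set11.
rewrite -[RHS](card_in_imset (f := fun Q => B |: Q)) => [|Q1 Q2]; last first.
  rewrite !inE => /andP[parQ1 _] /andP[parQ2 _] eqQ.
  by rewrite -(setU1K (Bnot _ parQ1)) eqQ setU1K ?Bnot.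
apply: eq_card => P; rewrite !inE; apply/idP/imsetP.
  move=> /andP[/andP[parP /forall_inP avP] BP].
  exists (P :\ B); last by rewrite setD1K.
  rewrite inE partitionD1 //=; apply/forall_inP => s sS.
  by rewrite !inE negb_and avP ?orbT.
case=> Q; rewrite inE => /andP[parQ /forall_inP avQ] ->{P}.
rewrite setU11 andbT; apply/andP; split.
  have <-: B :|: (D :\: B) = D.
    by apply/setP => y; rewrite !inE; case: (boolP (y \in B)) => // /(subsetP sBD).
  by rewrite partitionU1 // -setI_eq0; apply/eqP/setP => y; rewrite !inE; case: (y \in B).
by apply/forall_inP => s sS; rewrite !inE negb_or neqB //= avQ.
Qed.

Lemma card_partitions_avoidingU1 D S x :
    x \in D -> x \notin S -> S \subset D ->
  #|partitions_avoiding D S|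
    = #|partitions_avoiding D (x |: S)| + #|partitions_avoiding (D :\ x) S|.
Proof.
move=> xD xS sSD.
rewrite -(card_partitions_avoiding_block (B := [set x])) ?sub1set //; last first.
- by rewrite subsetD1 sSD.
- by apply/set0Pn; exists x; rewrite set11.
rewrite -(cardsID [set P : {set {set T}} | [set x] \in P]) addnC.
congr (_ + _); apply: eq_card => P; rewrite !inE //.
rewrite andbCA; congr (_ && _).
apply/andP/forall_inP => [[xP /forall_inP avP] s|avP].
  by rewrite !inE => /predU1P[->|/avP].
by split; [|apply/forall_inP => s sS]; apply: avP; rewrite !inE ?eqxx ?sS ?orbT.
Qed.

(** Classify the partitions by the complement [C] in [D] of the block containing [x]. The fibre over
    [C] consists of the partitions having [D :\: C] as a block. *)
Lemma card_partitions_rec D x : x \in D ->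
  #|partitions_avoiding D set0|
    = \sum_(C : {set T} | C \subset D :\ x) #|partitions_avoiding C set0|.
Proof.
move=> xD; rewrite -sum1_card.
rewrite (partition_big (fun P => D :\: pblock P x)
          (fun C : {set T} => C \subset D :\ x)) /=; last first.
  move=> P; rewrite inE => /andP[parP _]; apply/setDS.
  by rewrite sub1set mem_pblock (cover_partition parP).
apply: eq_bigr => C; rewrite subsetD1 => /andP[sCD xC].
have DDC : D :\: (D :\: C) = C by rewrite setDDr setDv set0U; apply/setIidPr.
rewrite -[in RHS]DDC -card_partitions_avoiding_block ?subsetDl ?sub0set //; last first.
  by apply/set0Pn; exists x; rewrite !inE xC.
rewrite sum1dep_card; apply: eq_card => P; rewrite !inE; apply: andb_id2l.
case/andP=> parP _; apply/eqP/idP => [<-|DCP].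
  rewrite setDDr setDv set0U (setIidPr _) ?(partitionS parP) //;
  by rewrite pblock_mem ?(cover_partition parP).
rewrite (def_pblock (partition_trivIset parP) DCP) //.
by rewrite !inE xC.
Qed.

Lemma partitions_avoiding_set0 :
  partitions_avoiding (set0 : {set T}) set0 = [set set0].
Proof.
apply/setP => P; rewrite !inE partition_set0.
by case: eqP => //= _; apply/forall_inP => s; rewrite inE.
Qed.

Lemma sum_subset_card (E : {set T}) (g : nat -> nat) :
  \sum_(C : {set T} | C \subset E) g #|C|
    = \sum_(j < #|E|.+1) 'C(#|E|, j) * g j.
Proof.
rewrite (partition_big (fun C : {set T} => inord #|C| : 'I_(#|E|.+1)) xpredT) //=.
apply: eq_bigr => j _; rewrite -cards_draws -sum_nat_const.
apply: congr_big => // [C|C /andP[sCE]].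
  rewrite inE; apply: andb_id2l => sCE.
  by rewrite -val_eqE /= inordK // ltnS subset_leq_card.
by rewrite -val_eqE /= inordK ?ltnS ?subset_leq_card // => /eqP->.
Qed.

End PartitionsAvoiding.

(** Strong induction on the cardinality, with the type generalized: [D] and the full set of
    ['I_#|D|] satisfy the same recurrence, whose terms are Bell numbers by induction. *)
Lemma card_partitions (T : finType) (D : {set T}) :
  #|partitions_avoiding D set0| = bell #|D|.
Proof.
have [n] := ubnP #|D|; elim: n => // n IHn in T D *; rewrite ltnS => leDn.
have [D0|[x xD]] := set_0Vmem D.
  suff E0 : [set: 'I_#|D|] = set0.
    by rewrite /bell E0 {1}D0 !partitions_avoiding_set0 !cards1.
  by apply/eqP; rewrite -cards_eq0 cardsT card_ord D0 cards0.
have cardI : #|[set: 'I_#|D|]| = #|D| by rewrite cardsT card_ord.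
have [y yI] : exists y, y \in [set: 'I_#|D|].
  by apply/set0Pn; rewrite -card_gt0 cardI card_gt0; apply/set0Pn; exists x.
have rec U (E : {set U}) z : z \in E -> #|E| = #|D| ->
    #|partitions_avoiding E set0| = \sum_(j < #|D|.-1.+1) 'C(#|D|.-1, j) * bell j.
  move=> zE cE; have cEz : #|E :\ z| = #|D|.-1 by rewrite -cE (cardsD1 z E) zE.
  have D_gt0 : 0 < #|D| by rewrite -cE card_gt0; apply/set0Pn; exists z.
  rewrite (card_partitions_rec zE).
  rewrite -cEz -sum_subset_card; apply: eq_bigr => C /subset_leq_card leC.
  by apply: IHn; rewrite (leq_ltn_trans leC) // cEz prednK.
by rewrite (rec _ _ _ xD) // /bell (rec _ _ _ yI).
Qed.

Lemma bellS n : bell n.+1 = \sum_(j < n.+1) 'C(n, j) * bell j.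
Proof.
rewrite {1}/bell (card_partitions_rec (in_setT ord0)).
under eq_bigr do rewrite card_partitions.
by rewrite sum_subset_card cardsDS ?subsetT // cardsT cards1 card_ord subn1.
Qed.

(** * The Bell functional and its shift identities *)

Section BellFunctional.

Local Open Scope ring_scope.

Variable R : comNzRingType.
Implicit Types f g : {poly R}.

Definition bell_functional f : R := \sum_(i < size f) f`_i * (bell i)%:R.

Local Notation L := bell_functional.

Lemma bell_functional_widen n f : (size f <= n)%N ->
  L f = \sum_(i < n) f`_i * (bell i)%:R.
Proof.
move=> le_fn; rewrite /L (big_ord_widen n (fun i => f`_i * (bell i)%:R)) //.
rewrite big_mkcond; apply: eq_bigr => i _.
by case: ltnP => // le_fi; rewrite nth_default ?mul0r.
Qed.

Lemma bell_functional_is_linear : linear_for *%R L.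
Proof.
move=> a f g; pose n := maxn (size f) (size g).
rewrite !(@bell_functional_widen n) ?leq_maxl ?leq_maxr //; last first.
  rewrite (leq_trans (size_polyD _ _)) // geq_max leq_maxr andbT.
  by rewrite (leq_trans (size_scale_leq _ _)) ?leq_maxl.
rewrite mulr_sumr -big_split /=; apply: eq_bigr => i _.
by rewrite coefD coefZ mulrDl mulrA.
Qed.

HB.instance Definition _ :=
  GRing.isLinear.Build R {poly R} R *%R bell_functional bell_functional_is_linear.

Lemma bell_functionalXn n : L 'X^n = (bell n)%:R.
Proof.
rewrite /L size_polyXn big_ord_recr /= coefXn eqxx mul1r big1 ?add0r // => i _.
by rewrite coefXn ltn_eqF ?mul0r.
Qed.

(** By linearity it suffices to treat [f = 'X^i], where expanding [('X + 1) ^+ i] gives exactly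
    [bellS]. *)
Lemma bell_functionalXM f : L ('X * f) = L (f \Po ('X + 1)).
Proof.
rewrite -[f]coefK poly_def mulr_sumr !raddf_sum /=.
apply: eq_bigr => i _.
rewrite -scalerAr -exprS comp_polyZ comp_Xn_poly !linearZ /=; congr (_ * _).
rewrite bell_functionalXn bellS natr_sum addrC exprDn raddf_sum /=.
apply: eq_bigr => j _.
by rewrite expr1n mul1r raddfMn /= bell_functionalXn natrM mulr_natl.
Qed.

Lemma bell_functional_ffact j f :
  L (\prod_(i < j) ('X - i%:R%:P) * f) = L (f \Po ('X + j%:R%:P)).
Proof.
elim: j f => [|j IHj] f; first by rewrite big_ord0 mul1r addr0 comp_polyXr.
rewrite big_ord_recl subr0.
(* Once the factor ['X] is split off, the remaining factors are those of the shorter product shifted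
   by ['X - 1]; the shift ['X + 1] coming from [bell_functionalXM] cancels this. *)
have -> : \prod_(i < j) ('X - (lift ord0 i)%:R%:P)
          = (\prod_(i < j) ('X - i%:R%:P)) \Po ('X - 1) :> {poly R}.
  rewrite rmorph_prod /=; apply: eq_bigr => i _.
  by rewrite comp_polyB comp_polyX comp_polyC /bump /= mulrS polyCD opprD addrA.
rewrite -mulrA bell_functionalXM comp_polyM -comp_polyA.
have -> : ('X - 1) \Po ('X + 1) = 'X :> {poly R}.
  by rewrite comp_polyB comp_polyX comp_polyC addrK.
rewrite comp_polyXr IHj -comp_polyA; congr (L (_ \Po _)).
by rewrite comp_polyD comp_polyX comp_polyC mulrSr polyCD addrA.
Qed.

(** Inclusion-exclusion, one element at a time: forbidding [[set x]] subtracts the partitions of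
    [D :\ x], which turns one factor ['X] into ['X - 1]. *)
Lemma card_partitions_avoiding (T : finType) (D S : {set T}) : S \subset D ->
  #|partitions_avoiding D S|%:R = L ('X^#|D :\: S| * ('X - 1) ^+ #|S|).
Proof.
move cS : #|S| => s; elim: s => [|s IHs] in D S cS *.
  move=> _; move/eqP: cS; rewrite cards_eq0 => /eqP ->.
  by rewrite card_partitions setD0 mulr1 bell_functionalXn.
move=> sSD.
have [x xS] : exists x, x \in S by apply/set0Pn; rewrite -card_gt0 cS.
have xD := subsetP sSD x xS.
have xS' : x \notin S :\ x by rewrite !inE eqxx.
have cS' : #|S :\ x| = s by move: cS; rewrite (cardsD1 x) xS => -[].
have sS'D : S :\ x \subset D by apply: subset_trans (subsetDl _ _) sSD.
have := card_partitions_avoidingU1 xD xS' sS'D.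
rewrite setD1K // => /(congr1 (fun n => n%:R : R)); rewrite natrD => /eqP.
rewrite -subr_eq => /eqP <-; rewrite !IHs ?setSD //.
have eqD : (D :\ x) :\: (S :\ x) = D :\: S.
  apply/setP=> y; rewrite !inE; case: (eqVneq y x) => [->|] //=.
  by rewrite xS.
have cD : #|D :\: (S :\ x)| = #|D :\: S|.+1.
  rewrite (cardsD1 x) !inE eqxx xD /= add1n; congr _.+1; apply: eq_card => y.
  by rewrite !inE; case: (eqVneq y x) => [->|] //=; rewrite xS.
rewrite eqD cD -raddfB /= -mulrBl exprSr -[X in _ - X]mulr1 -mulrBr.
by rewrite -mulrA -exprS.
Qed.

End BellFunctional.

(** * The numbers [A n k] as values of the Bell functional *)

Lemma A_partitions_avoiding n (i : 'I_n.+1) :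
  A n i = #|partitions_avoiding [set~ i] [set j : 'I_n.+1 | i < j]|.
Proof.
rewrite -setTD -card_partitions_avoiding_block ?subsetT //; last first.
- by apply/subsetP => j; rewrite !inE => ij; rewrite -val_eqE gtn_eqF.
- by apply/set0Pn; exists i; rewrite set11.
apply: eq_card => P; rewrite !inE -andbA; congr (_ && _).
apply/existsP/andP => [[j /andP[/eqP/val_inj-> /andP[iP avP]]]|[avP iP]].
  split=> //; apply/forall_inP => s; rewrite inE => lt_is.
  by move/forallP: avP => /(_ s); rewrite lt_is.
exists i; rewrite eqxx /largest_singleton iP /=; apply/forallP => j.
by apply/implyP => lt_ij; move/forall_inP: avP; apply; rewrite inE.
Qed.

(** Once the block [[set i]] is removed, the [k] elements below [i] are free and the [r] elements
    above it are forbidden singletons. Writing [r + k] avoids truncated subtraction. *)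
Lemma A_bell_functional (R : comNzRingType) r k :
  ((A (r + k) k)%:R = bell_functional ('X^k * ('X - 1) ^+ r) :> R)%R.
Proof.
have ltk : k < (r + k).+1 by rewrite ltnS leq_addl.
pose i := Ordinal ltk; pose below := [set j : 'I_(r + k).+1 | j < k].
rewrite (A_partitions_avoiding i) card_partitions_avoiding; last first.
  by apply/subsetP => j; rewrite !inE -val_eqE => lt_kj; rewrite gtn_eqF.
have c_below : #|below| = k.
  by rewrite -sum1dep_card -(big_ord_widen _ (fun=> 1)) ?sum1_card ?card_ord // ltnW.
have -> : [set~ i] :\: [set j : 'I_(r + k).+1 | i < j] = below.
  by apply/setP => j; rewrite !inE -val_eqE -leqNgt [RHS]ltn_neqAle andbC.
have -> : [set j : 'I_(r + k).+1 | i < j] = [set~ i] :\: below.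
  by apply/setP => j; rewrite !inE -val_eqE -leqNgt ltn_neqAle andbC eq_sym.
rewrite cardsDS; last first.
  by apply/subsetP => j; rewrite !inE -val_eqE => lt_jk; rewrite ltn_eqF.
by rewrite c_below cardsC1 card_ord addnK.
Qed.

(** * Reduction modulo [p] *)

Section Touchard.

Local Open Scope ring_scope.

Variables (p : nat) (hp : prime p).
Implicit Type f : {poly 'F_p}.

Lemma bell_functional_Fp f :
  bell_functional ('X^p * f) = bell_functional (('X + 1) * f).
Proof.
have genX : \prod_(i < p) ('X - i%:R%:P) = 'X^p - 'X :> {poly 'F_p}.
  have := finField_genPoly 'F_p; rewrite card_Fp // => ->.
  rewrite -(big_mkord xpredT (fun i => 'X - i%:R%:P)).
  (* The elements of ['F_p] are ordinals whose bound is only propositionally equal to [p], so the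
     range is cast before the two products are matched. *)
  rewrite -[X in index_iota 0 X](Fp_cast hp).
  by rewrite big_mkord; apply: eq_bigr => i _; rewrite natr_Zp.
have := bell_functional_ffact p f.
(* In characteristic [p] the shift by [p] is the identity. *)
rewrite genX pchar_Fp_0 // addr0 comp_polyXr mulrBl raddfB /= => /eqP.
by rewrite subr_eq => /eqP ->; rewrite mulrDl mul1r raddfD addrC.
Qed.

(** Frobenius gives [('X - 1) ^+ p = 'X^p - 1], and each such factor acts as ['X] by
    [bell_functional_Fp]. The induction on [m] lets [f] vary to absorb the remaining factor. *)
Lemma bell_functional_subX1p m f :
  bell_functional (('X - 1) ^+ (p * m) * f) = bell_functional ('X^m * f).
Proof.
have X1p : ('X - 1) ^+ p = 'X^p - 1 :> {poly 'F_p}.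
  have pcharX : p \in [pchar {poly 'F_p}] by rewrite pchar_poly pchar_Fp.
  by rewrite -!(pFrobenius_autE pcharX) rmorphB rmorph1.
rewrite exprM X1p; elim: m f => [|m IHm] f; first by rewrite !expr0.
rewrite exprSr -mulrA IHm mulrCA mulrBl mul1r raddfB /= bell_functional_Fp.
by rewrite mulrDl mul1r raddfD /= addrK mulrA -exprS.
Qed.

End Touchard.

Theorem theorem4p1 (p : nat) (hp : prime p) (n m k : nat) :
  A (n + p * m + k) k = A (n + m + k) (m + k) %[mod p].
Proof.
(* Residues modulo [p] become elements of ['F_p]. The exponent of ['X - 1] is [n + p * m] on the
   left and [n] on the right. *)
rewrite -!val_Fp_nat // -(addnA n m k) !A_bell_functional; congr (val _).
rewrite addnC exprD mulrCA bell_functional_subX1p // exprD.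
by rewrite -!mulrA.
Qed.
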